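(* Let $p>1$ and $q>1$ be real numbers with $\frac1p+\frac1q=1$. For nonnegative random variables $X,Y$ defined on a common probability space with $\|X\|_p+\|Y\|_p+\|Y\|_q<\infty$, and for $\vartheta\in[0,1]$, define $$\mathcal{E}_{p,\vartheta}(X):=\big(\|X\|_p^p-\vartheta^p\|X\|_1^p\big)^{1/p},\qquad \mathcal{C}_{p,\vartheta}(X,Y):=\mathbb{E}X^{p-1}Y-\vartheta^p(\mathbb{E}X)^{p-1}\,\mathbb{E}Y.$$ (a) If $p\le 2$ (so $1<p\le2$), then for all $\vartheta\in[0,1]$ and all such $X,Y$, $$\mathcal{E}_{p,\vartheta}(X+Y)\le\mathcal{E}_{p,\vartheta}(X)+\mathcal{E}_{p,\vartheta}(Y)$$ and $$\mathcal{C}_{p,\vartheta}(X,Y)\le\mathcal{E}_{p,\vartheta}(X)^{p-1}\,\mathcal{E}_{p,\vartheta}(Y).$$ (b) For any real $p>2$ and any $\vartheta\in(0,1]$, neither of these two inequalities holds in general: there exist such nonnegative $X,Y$ for which the first inequality fails, and there exist such nonnegative $X,Y$ for which the second inequality fails.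
   Context: $\|X\|_r:=(\mathbb{E}|X|^r)^{1/r}$. The quantity $\mathcal{E}_{p,\vartheta}(X)$ is well defined (the expression under the $p$th root is nonnegative) since $\|X\|_1\le\|X\|_p$. For $\vartheta=0$ the two inequalities reduce to the Minkowski and Hölder inequalities, and for $\vartheta=1$, $\mathcal{E}_{p,1}(X)=(\|X\|_p^p-\|X\|_1^p)^{1/p}$ is the ''$p$-excess'' of $X$. *)

(* Defs.v *)
From HB Require Import structures.
From mathcomp Require Import all_boot all_order all_algebra.
From mathcomp Require Import all_classical all_reals all_analysis.
Unset Printing Implicit Defensive.
Import Order.TTheory GRing.Theory Num.Theory.
Local Open Scope ring_scope.

(* ||X||_r as a real number (used only when it is finite):
   ||X||_r = (E |X|^r)^(1/r), via the library L^r norm. *)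
Definition pnorm {d} {T : measurableType d} {R : realType}
  (P : probability T R) (r : R) (X : T -> R) : R :=
  fine ('N[P]_(r%:E)[EFin \o X])%E.

Definition Ecal {d} {T : measurableType d} {R : realType}
  (P : probability T R) (p theta : R) (X : T -> R) : R :=
  (pnorm P p X `^ p - theta `^ p * pnorm P 1 X `^ p) `^ p^-1.

Definition Ccal {d} {T : measurableType d} {R : realType}
  (P : probability T R) (p theta : R) (X Y : T -> R) : R :=
  fine ('E_P[fun w => (X w `^ (p - 1) * Y w)%R])%E
  - theta `^ p * (fine 'E_P[X]) `^ (p - 1) * fine 'E_P[Y].

Definition admissible {d} {T : measurableType d} {R : realType}
  (P : probability T R) (p q : R) (X Y : {RV P >-> R}) : Prop :=
  [/\ (forall w, 0 <= X w), (forall w, 0 <= Y w),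
      ('N[P]_(p%:E)[EFin \o X] < +oo)%E,
      ('N[P]_(p%:E)[EFin \o Y] < +oo)%E &
      ('N[P]_(q%:E)[EFin \o Y] < +oo)%E].

(* Main.v *)
(* Write F(X) = E X^p - theta^p (E X)^p.  For 1 < p <= 2 the Bregman divergence
   G(x, y) = y^p - p x^(p-1) y + (p-1) x^p is jointly convex, so it lies above its
   tangent plane at (E X, E Y) and Jensen gives E G(X, Y) >= G(E X, E Y) >= 0, hence
   p C(X, Y) <= F(Y) + (p-1) F(X).  Replacing Y by t Y and optimizing in t > 0 gives
   the Hoelder-type inequality; since F(Z) = C(Z, X) + C(Z, Y) for Z = X + Y, the
   Minkowski-type one follows, for every p > 1 for which the former holds.

   For p > 2, on a fair coin let X_s take the values s and 1.  Near s = 0, the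
   function s |-> F(X_s) differs from a strictly concave one by O(s^p) = o(s^2), so
   2 F(X_t) > F(X_0) + F(X_2t) for small t; as x^(1/p) is concave, the Minkowski-type
   inequality fails for X_0 and X_2t, and so must the Hoelder-type one. *)
Require Import Defs.
From HB Require Import structures.
From mathcomp Require Import all_boot all_order all_algebra.
From mathcomp Require Import all_classical all_reals all_analysis.
From mathcomp Require Import measurable_realfun ring lra.
Import Order.TTheory GRing.Theory Num.Theory.
Import numFieldNormedType.Exports.
Local Open Scope classical_set_scope.
Local Open Scope ring_scope.

(** * Convexity and continuity of real powers *)

Lemma powR_conv {R : realType} (r t x y : R) : 1 <= r -> 0 <= t <= 1 ->
  0 <= x -> 0 <= y ->
  (t * x + (1 - t) * y) `^ r <= t * x `^ r + (1 - t) * y `^ r.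
Proof.
move=> r1 /andP[t0 t1] x0 y0.
have := @convex_powR R r r1 (Itv01 t0 t1) x y.
by rewrite !inE/= !in_itv/= !andbT !convRE/=; apply.
Qed.

(** Away from 0 the power is differentiable; at 0, |x| < e^(1/r) gives |x|^r < e. The absolute value
    is there because [powR] takes a default value at negative bases. *)
Lemma continuous_normr_powR {R : realType} (r : R) : 0 < r ->
  continuous (fun x : R => `|x| `^ r).
Proof.
move=> r0 x; have [->|x0] := eqVneq x 0; last first.
  apply: (@continuous_comp _ _ _ (fun y : R => `|y|) (@powR R ^~ r) x).
    exact: norm_continuous.
  apply: differentiable_continuous; apply/derivable1_diffP.
  by apply: derivable_powR; rewrite in_itv/= andbT normr_gt0.
apply/cvgrPdist_lt => e e0; rewrite normr0 powR0 ?gt_eqF//.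
near=> z; rewrite sub0r normrN ger0_norm ?powR_ge0//.
have -> : e = (e `^ r^-1) `^ r by rewrite -powRrM mulVf ?gt_eqF// powRr1 ?ltW.
apply: gt0_ltr_powR; rewrite ?nnegrE ?powR_ge0//.
near: z; exists (e `^ r^-1); first by rewrite /= powR_gt0.
by move=> y /=; rewrite sub0r normrN.
Unshelve. all: by end_near. Qed.

Lemma within_continuous_powR {R : realType} (r c a b : R) : 0 < r -> 0 <= a + c ->
  {within `[a, b], continuous (fun x : R => (x + c) `^ r)}.
Proof.
move=> r0 ac; apply: (@subspace_eq_continuous _ _ _ (fun x => `|x + c| `^ r)).
  move=> x; rewrite inE/= in_itv/= => /andP[ax _].
  by rewrite ger0_norm// (le_trans ac)// lerD2r.
apply: continuous_subspaceT => x.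
apply: (@continuous_comp _ _ _ (fun x => x + c) (fun x : R => `|x| `^ r)).
  by apply: continuousD; [exact: id|exact: cst_continuous].
exact: continuous_normr_powR.
Qed.

(** * A one-variable inequality: nonnegativity of the dual gap *)

(* With x = u^(q-1), b = v^(q-1) and p = q / (q-1), this is, up to the
   factor p - 1, the gap between G and its tangent plane at (1, b) minimized in y. *)
Definition dual_gap {R : realType} (q v u : R) :=
  u `^ q + v `^ q - 1 + q / (q - 1) * (u `^ (q - 1) - 1) * (v `^ (q - 1) - 1)
  - (u + (v - 1)) `^ q.

Definition dual_gap' {R : realType} (q v u : R) :=
  q * (u `^ (q - 1 - 1) * (u + v `^ (q - 1) - 1) - (u + (v - 1)) `^ (q - 1)).

Lemma is_derive_dual_gap {R : realType} (q v u : R) : 2 <= q -> 0 < u -> 0 < u + (v - 1) ->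
  is_derive u 1 (dual_gap q v) (dual_gap' q v u).
Proof.
move=> q2 u0 uv0.
have q0 : 0 < q - 1 by lra.
have q1 : q - 1 != 0 by rewrite gt_eqF.
have d1 := is_derive1_powR q u0.
have d2 := is_derive1_powR (q - 1) u0.
have d3 := is_derive1_powR q uv0.
have d4 : is_derive u 1 (fun x : R => (x + (v - 1)) `^ q) (q * (u + (v - 1)) `^ (q - 1)).
  apply: (is_derive_eq (@is_derive1_comp _ (@powR R ^~ q) (fun x => x + (v - 1))
    u _ _ d3 _)).
  by rewrite addr0 mulr1.
rewrite /dual_gap; apply: is_derive_eq.
rewrite /dual_gap' /GRing.scale/=.
have -> : u `^ (q - 1) = u * u `^ (q - 1 - 1) by rewrite mulr_powRB1// ?ltW//; lra.
by field.
Qed.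

Lemma continuous_dual_gap {R : realType} (q v a b : R) : 2 <= q -> 0 <= a -> 1 <= a + v ->
  {within `[a, b], continuous (dual_gap q v)}.
Proof.
move=> q2 a0 av.
have c0 r : 0 < r -> {within `[a, b], continuous (fun x : R => x `^ r)}.
  move=> r0; rewrite (_ : (fun x => _) = (fun x : R => (x + 0) `^ r)).
    by apply: within_continuous_powR; rewrite ?addr0.
  by apply/funext => x; rewrite addr0.
have c1 := @within_continuous_powR R q (v - 1) a b.
have cc (k : R) : {within `[a, b], continuous (fun _ : R => k)}.
  by apply: continuous_subspaceT => x; exact: cst_continuous.
have cD (f g : R -> R) : {within `[a, b], continuous f} -> {within `[a, b], continuous g} ->
  {within `[a, b], continuous (fun x => f x + g x)}.
  by move=> cf cg x; apply: continuousD; [exact: cf|exact: cg].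
have cM (f g : R -> R) : {within `[a, b], continuous f} -> {within `[a, b], continuous g} ->
  {within `[a, b], continuous (fun x => f x * g x)}.
  by move=> cf cg x; apply: continuousM; [exact: cf|exact: cg].
have cN (f : R -> R) : {within `[a, b], continuous f} ->
  {within `[a, b], continuous (fun x => - f x)}.
  by move=> cf x; apply: continuousN; exact: cf.
apply: (cD _ _ _ (cN _ _)); last by apply: c1; lra.
have q1 : 0 < q - 1 by lra.
have q0 : 0 < q by lra.
apply: (cD); first by do 2 (apply: (cD) => //); exact: c0.
by do 2 (apply: (cM) => //); apply: (cD) => //; exact: c0.
Qed.

Lemma dual_gap1 {R : realType} (q v : R) : dual_gap q v 1 = 0.
Proof. by rewrite /dual_gap !powR1 addrC subrKC; ring. Qed.

(** Write c + v - 1 = c (v/c + (1 - 1/c)). Since q >= 2, z^(q-1) is convex, which bounds (c + v -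
    1)^(q-1) by c^(q-2) (v^(q-1) + c - 1). *)
Lemma dual_gap'_ge0 {R : realType} (q v c : R) : 2 <= q -> 0 <= v -> 1 < c ->
  0 <= dual_gap' q v c.
Proof.
move=> q2 v0 c1; rewrite mulr_ge0 ?subr_ge0//; first lra.
have c0 : 0 < c by lra.
have -> : c + (v - 1) = c * (c^-1 * v + (1 - c^-1) * 1) by field; rewrite gt_eqF.
have m0 : 0 < q - 1 by lra.
have ci : 0 <= c^-1 <= 1 by rewrite invr_ge0 ltW//= invf_le1// ltW.
rewrite powRM ?(ltW c0)//; last by case/andP: ci => ? ?; rewrite addr_ge0// mulr_ge0//; lra.
rewrite -(mulr_powRB1 (ltW c0) m0) mulrAC mulrC.
rewrite ler_wpM2l ?powR_ge0//.
have m1 : 1 <= q - 1 by lra.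
have := powR_conv _ _ _ _ m1 ci v0 ler01.
rewrite powR1 => /(ler_wpM2l (ltW c0)) /le_trans; apply.
rewrite le_eqVlt; apply/orP; left; apply/eqP; field; by rewrite gt_eqF.
Qed.

(** For c < 1 it is v that is a convex combination: v = c w + (1 - c) with w = (c + v - 1) / c,
    where c + v >= 1 makes w nonnegative. *)
Lemma dual_gap'_le0 {R : realType} (q v c : R) : 2 <= q -> 0 <= v -> 0 < c < 1 ->
  1 <= c + v -> dual_gap' q v c <= 0.
Proof.
move=> q2 v0 /andP[c0 c1] cv; rewrite mulr_ge0_le0 ?subr_le0//; first lra.
have m0 : 0 < q - 1 by lra.
have m1 : 1 <= q - 1 by lra.
have c01 : 0 <= c <= 1 by rewrite !ltW.
have w0 : 0 <= (c + (v - 1)) / c by rewrite divr_ge0//; lra.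
have := powR_conv _ _ _ _ m1 c01 w0 ler01.
have -> : c * ((c + (v - 1)) / c) + (1 - c) * 1 = v by field; rewrite gt_eqF.
rewrite powR1 => h.
have -> : (c + (v - 1)) `^ (q - 1) =
    c `^ (q - 1 - 1) * (c * ((c + (v - 1)) / c) `^ (q - 1)).
  rewrite mulrA [_ * c]mulrC mulr_powRB1// ?(ltW c0)// -powRM// ?(ltW c0)//.
  by rewrite mulrC divfK// gt_eqF.
by rewrite ler_wpM2l ?powR_ge0//; lra.
Qed.

(** As a function of u the gap vanishes at 1, with derivative <= 0 before 1 and >= 0 after it; the
    mean value theorem between u and 1 concludes. *)
Lemma dual_gap_ge0 {R : realType} (q v u : R) : 2 <= q -> 0 <= v -> 0 <= u -> 1 <= u + v ->
  (u + v - 1) `^ q <=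
  u `^ q + v `^ q - 1 + q / (q - 1) * (u `^ (q - 1) - 1) * (v `^ (q - 1) - 1).
Proof.
move=> q2 v0 u0 uv; rewrite -subr_ge0 -[X in _ - X `^ _]addrA -/(dual_gap q v u).
have [u1|u1|->] := ltgtP u 1; last by rewrite dual_gap1.
- have [||c] := @MVT R (dual_gap q v) (dual_gap' q v) u 1 u1.
  + by move=> x; rewrite in_itv/= => /andP[ux x1]; apply: is_derive_dual_gap; lra.
  + exact: continuous_dual_gap.
  rewrite in_itv/= dual_gap1 => /andP[uc c1] /eqP.
  rewrite sub0r eqr_oppLR => /eqP ->; rewrite -mulNr mulr_ge0//; last lra.
  by rewrite oppr_ge0 dual_gap'_le0//; lra.
- have [||c] := @MVT R (dual_gap q v) (dual_gap' q v) 1 u u1.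
  + by move=> x; rewrite in_itv/= => /andP[ux x1]; apply: is_derive_dual_gap; lra.
  + by apply: continuous_dual_gap => //; lra.
  rewrite in_itv/= dual_gap1 subr0 => /andP[uc c1] ->.
  by rewrite mulr_ge0 ?dual_gap'_ge0//; lra.
Qed.

(** * Pointwise inequalities: the tangent plane of G, and Young's inequality *)

(* The gap at (x, y) between G and its tangent plane at (1, b): it is symmetric in x
   and b. *)
Lemma bregman_tangent {R : realType} (p b x y : R) : 1 < p <= 2 ->
  0 <= b -> 0 <= x -> 0 <= y ->
  0 <= y `^ p - p * y * (x `^ (p - 1) + b `^ (p - 1) - 1)
       + (p - 1) * (x `^ p + b `^ p - 1 + p * (x - 1) * (b - 1)).
Proof.
move=> /andP[p1 p2] b0 x0 y0.
have m0 : 0 < p - 1 by lra.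
have p0 : 0 < p by lra.
(* The exponent conjugate to p; p <= 2 gives q >= 2, as [dual_gap_ge0] requires. *)
pose q := p / (p - 1).
have qE : q / (q - 1) = p by rewrite /q; field; apply/andP; split; rewrite gt_eqF//; lra.
have q2 : 2 <= q by rewrite /q ler_pdivlMr//; lra.
have q0 : 0 < q by lra.
have pq : p^-1 + q^-1 = 1 by rewrite /q; field; rewrite !gt_eqF.
have powq (z : R) : 0 <= z -> (z `^ (p - 1)) `^ q = z `^ p.
  by move=> z0; rewrite -powRrM; congr (_ `^ _); rewrite /q; field; rewrite gt_eqF.
have powq1 (z : R) : 0 <= z -> (z `^ (p - 1)) `^ (q - 1) = z.
  move=> z0; rewrite -powRrM -[RHS]powRr1//; congr (_ `^ _); rewrite /q; field.
  by rewrite gt_eqF.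
have youngp z : p * (z / p) = z by field; rewrite gt_eqF.
have youngq z : p * (z / q) = (p - 1) * z by rewrite /q; field; rewrite !gt_eqF.
(* When the coefficient of - p y is nonnegative, Young's inequality eliminates y.
   Otherwise y only helps, and Young's inequality for x (1 - b) bounds the remaining
   bracket below by its value at x = (1-b)^(q-1), where that coefficient is
   nonnegative. *)
have [s0|s0] := leP 1 (x `^ (p - 1) + b `^ (p - 1)).
  have := dual_gap_ge0 q _ _ q2 (powR_ge0 b (p - 1)) (powR_ge0 x (p - 1)) s0.
  rewrite qE !powq// !powq1//.
  set s := x `^ (p - 1) + b `^ (p - 1) - 1 => h.
  have s0' : 0 <= s by rewrite subr_ge0.
  clearbody s.
  have := conjugate_powR y0 s0' p0 q0 pq.
  rewrite -(ler_pM2l p0) [X in _ <= X]mulrDr youngp youngq.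
  by move: h => /(ler_wpM2l (ltW m0)); lra.
(* Here b^(p-1) < 1, so b <= 1, and then p - 1 <= 1 gives b <= b^(p-1). Hence u = 1 - b and v =
   b^(p-1) satisfy u + v >= 1. *)
have b1 : b <= 1.
  rewrite leNgt; apply/negP => b1.
  have := ler_powR (ltW b1) (ltW m0); rewrite powRr0.
  by have := powR_ge0 x (p - 1); lra.
have bm : b <= b `^ (p - 1).
  move: b0; rewrite le_eqVlt => /predU1P[<-|b0]; first exact: powR_ge0.
  by rewrite ger1_powR// ?b0//; lra.
have c0 : 0 <= 1 - b by lra.
have c1 : 1 <= (1 - b) + b `^ (p - 1) by lra.
have := dual_gap_ge0 q _ _ q2 (powR_ge0 b (p - 1)) c0 c1.
rewrite qE powq// powq1// => /(le_trans (powR_ge0 _ _)) h.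
have := mulr_powRB1 c0 q0.
have := conjugate_powR x0 c0 p0 q0 pq.
rewrite -(ler_pM2l p0) [X in _ <= X]mulrDr youngp youngq.
set cq := (1 - b) `^ q in h *; set cq1 := (1 - b) `^ (q - 1) in h *.
move=> h1 h2.
rewrite addr_ge0// ?mulr_ge0//; first last.
- have : p * (1 - b) * cq1 = p * cq by rewrite -h2; ring.
  lra.
- exact: ltW.
- have : 0 <= p * y * (1 - (x `^ (p - 1) + b `^ (p - 1))).
    by rewrite !mulr_ge0//; lra.
  by have := powR_ge0 y p; lra.
Qed.

(* Both sides are written as three-term linear combinations, to match [Rintegral_lin3]. *)
Lemma bregman_tangent_at {R : realType} (p a b x y : R) : 1 < p <= 2 ->
  0 < a -> 0 <= b -> 0 <= x -> 0 <= y ->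
  p * (p - 1) * (a `^ (p - 1) - a `^ (p - 1) * (b / a)) * x
    + p * (b `^ (p - 1) - a `^ (p - 1)) * y
    + - (p - 1) * (b `^ p - p * a `^ (p - 1) * b + (p - 1) * a `^ p) * 1
  <= 1 * y `^ p + - p * (x `^ (p - 1) * y) + (p - 1) * x `^ p.
Proof.
move=> p12 a0.
(* Both sides are homogeneous of degree p in (a, b, x, y), so dividing by a reduces to the tangent
   plane at (1, b). *)
have scale z : 0 <= z -> exists2 z', 0 <= z' & z = a * z'.
  move=> z0; exists (z / a); first by rewrite divr_ge0// ltW.
  by rewrite mulrC divfK// gt_eqF.
move=> /scale[{}b b0 ->] /scale[{}x x0 ->] /scale[{}y y0 ->].
have := bregman_tangent p b x y p12 b0 x0 y0.
have p0 : 0 < p by lra.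
rewrite !(@powRM R a)// ?(ltW a0)// -(mulr_powRB1 (ltW a0) p0).
have -> : a * b / a = b by field; rewrite gt_eqF.
move=> /(ler_wpM2l (mulr_ge0 (ltW a0) (powR_ge0 a (p - 1)))).
rewrite mulr0 -subr_ge0 => h; rewrite -subr_ge0; apply: le_trans h _.
rewrite -(mulr_powRB1 b0 p0) le_eqVlt; apply/orP; left; apply/eqP; ring.
Qed.

(** Young's inequality for x and a^(p-1), with conjugate exponents p and p / (p - 1); it says that
    G(a, x) >= 0. *)
Lemma young_powR {R : realType} (p x a : R) : 1 < p -> 0 <= x -> 0 <= a ->
  p * a `^ (p - 1) * x <= x `^ p + (p - 1) * a `^ p.
Proof.
move=> p1 x0 a0; have p0 : 0 < p by lra.
have m0 : 0 < p - 1 by lra.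
have q0 : 0 < p / (p - 1) by rewrite divr_gt0.
have pq : p^-1 + (p / (p - 1))^-1 = 1 by field; rewrite !gt_eqF.
have := conjugate_powR x0 (powR_ge0 a (p - 1)) p0 q0 pq.
rewrite -(ler_pM2l p0) -powRrM.
have -> : (p - 1) * (p / (p - 1)) = p by field; rewrite gt_eqF.
have -> : p * (x `^ p / p + a `^ p / (p / (p - 1))) = x `^ p + (p - 1) * a `^ p.
  by field; rewrite !gt_eqF.
lra.
Qed.

(** The choice t^p = B / A makes the right side p B, leaving C <= B / t. The cases A = 0 and B = 0
    are ruled out first, by a large and a small t respectively, when C > 0. *)
Lemma young_optimize {R : realType} (p A B C : R) : 1 < p -> 0 <= A -> 0 <= B ->
  (forall t, 0 < t -> p * t * C <= t `^ p * A + (p - 1) * B) ->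
  C <= (B `^ p^-1) `^ (p - 1) * A `^ p^-1.
Proof.
move=> p1 A0 B0 h; have p0 : 0 < p by lra.
have [C0|C0] := leP C 0; first by rewrite (le_trans C0)// mulr_ge0// powR_ge0.
have m0 : 0 < p - 1 by lra.
have {}A0 : 0 < A.
  rewrite lt_neqAle A0 andbT eq_sym; apply/eqP => A0'.
  have := h (B / C + 1); rewrite A0' mulr0 add0r.
  have -> : p * (B / C + 1) * C = p * B + p * C by field; rewrite gt_eqF.
  have t0 : 0 < B / C + 1 by rewrite ltr_wpDl// divr_ge0// ltW.
  by move=> /(_ t0); have := mulr_gt0 p0 C0; lra.
have {}B0 : 0 < B.
  rewrite lt_neqAle B0 andbT eq_sym; apply/eqP => B0'.
  (* This t has t^(p-1) = C / A, so t^p A = t C, which is smaller than p t C. *)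
  have t0 : 0 < (C / A) `^ (p - 1)^-1 by rewrite powR_gt0 ?divr_gt0.
  have := h _ t0; rewrite B0' mulr0 addr0 -(mulr_powRB1 (ltW t0) p0).
  rewrite -powRrM mulVf ?gt_eqF// powRr1; last by rewrite divr_ge0 ?ltW.
  set t := (C / A) `^ _ in t0 *; clearbody t.
  have -> : t * (C / A) * A = t * C by field; rewrite gt_eqF.
  have := mulr_gt0 t0 C0; have := mulr_gt0 m0 (mulr_gt0 t0 C0); lra.
have t0 : 0 < (B / A) `^ p^-1 by rewrite powR_gt0 ?divr_gt0.
have := h _ t0.
rewrite -powRrM mulVf ?gt_eqF// powRr1; last by rewrite divr_ge0 ?ltW.
rewrite divfK ?gt_eqF//.
have -> : B + (p - 1) * B = p * B by ring.
rewrite -mulrA ler_pM2l// -ler_pdivlMl// => /le_trans; apply.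
have B1 : 0 < B `^ p^-1 by rewrite powR_gt0.
have A1 : 0 < A `^ p^-1 by rewrite powR_gt0.
have BE : B = B `^ p^-1 * (B `^ p^-1) `^ (p - 1).
  by rewrite mulr_powRB1 ?(ltW B1)// -powRrM mulVf ?gt_eqF// powRr1// ltW.
rewrite [X in _ * X <= _]BE.
have -> : (B / A) `^ p^-1 = B `^ p^-1 / A `^ p^-1.
  apply: (canRL (mulfK _)); first by rewrite gt_eqF.
  by rewrite -powRM ?divfK ?gt_eqF// ?divr_ge0 ?ltW.
rewrite le_eqVlt; apply/orP; left; apply/eqP; field.
by rewrite !gt_eqF.
Qed.

(** * Moments on a probability space, and the inequalities for p <= 2 *)

Section moments.
Context {d} {T : measurableType d} {R : realType} (P : probability T R).
Implicit Types (X Y f g h : T -> R) (p theta : R).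

Local Notation integrableT f := (P.-integrable setT (EFin \o f)).

(** Shorter combinations are obtained below by giving surplus terms the coefficient 0. *)
Lemma integrable_lin3 (a b c : R) f g h :
  integrableT f -> integrableT g -> integrableT h ->
  integrableT (fun w => a * f w + b * g w + c * h w).
Proof.
move=> fi gi hi.
have kZ k u : integrableT u -> integrableT (fun w => k * u w).
  by move=> /(integrableZl measurableT k).
have iD u v : integrableT u -> integrableT v -> integrableT (fun w => u w + v w).
  by move=> ui vi; have := integrableD measurableT ui vi.
by apply: (iD); [apply: (iD)|]; exact: kZ.
Qed.

Lemma Rintegral_lin3 (a b c : R) f g h :
  integrableT f -> integrableT g -> integrableT h ->
  \int[P]_w (a * f w + b * g w + c * h w) =
  a * \int[P]_w f w + b * \int[P]_w g w + c * \int[P]_w h w.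
Proof.
move=> fi gi hi.
have kZ k u : integrableT u -> integrableT (fun w => k * u w).
  by move=> /(integrableZl measurableT k).
have iD u v : integrableT u -> integrableT v -> integrableT (fun w => u w + v w).
  by move=> ui vi; have := integrableD measurableT ui vi.
rewrite RintegralD//; [|by apply: iD; exact: kZ|exact: kZ].
rewrite RintegralD//; [|exact: kZ|exact: kZ].
by rewrite !RintegralZl.
Qed.

Lemma integrable_cst1 : integrableT (fun=> 1).
Proof. exact: finite_measure_integrable_cst. Qed.

Lemma Rintegral_cst1 : \int[P]_w (1 : R) = 1.
Proof.
rewrite Rintegral_cst// (_ : _ setT = 1%E) ?mulr1//; exact: probability_setT.
Qed.

Lemma measurable_fun_powR p X :
  measurable_fun setT X -> measurable_fun setT (fun w => X w `^ p).
Proof. exact: (@measurableT_comp _ _ _ _ _ _ (@powR R ^~ p)). Qed.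

(** If the norm is infinite, [fine] turns both sides into 0. *)
Lemma pnorm_powR p X : 0 < p -> (forall w, 0 <= X w) ->
  pnorm P p X `^ p = \int[P]_w (X w `^ p).
Proof.
move=> p0 X0; rewrite /pnorm /Rintegral.
have h := poweR_Lnorm P (EFin \o X) (lt0r_neq0 p0).
rewrite -(fine_poweR ('N[P]_(p%:E)[EFin \o X])%E p) h; congr fine.
apply: eq_integral => w _ /=.
by rewrite ger0_norm.
Qed.

Lemma pnorm1 X : (forall w, 0 <= X w) -> pnorm P 1 X = \int[P]_w X w.
Proof.
move=> X0; have := pnorm_powR 1 X ltr01 X0.
rewrite powRr1 ?fine_ge0 ?Lnorm_ge0// => ->.
by apply: eq_Rintegral => w _; rewrite powRr1.
Qed.

Lemma EcalE p theta X : 0 < p -> (forall w, 0 <= X w) -> Ecal P p theta X =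
  (\int[P]_w (X w `^ p) - theta `^ p * (\int[P]_w X w) `^ p) `^ p^-1.
Proof. by move=> p0 X0; rewrite /Ecal pnorm1// pnorm_powR. Qed.

Lemma CcalE p theta X Y : Ccal P p theta X Y =
  \int[P]_w (X w `^ (p - 1) * Y w)
  - theta `^ p * (\int[P]_w X w) `^ (p - 1) * \int[P]_w Y w.
Proof. by rewrite /Ccal !expectation.unlock. Qed.

(** Stated for bare functions, so that it passes to sums and multiples, and through integrability of
    X^p, the form that linearity of the integral uses. *)
Definition Lp_nonneg p X :=
  [/\ measurable_fun setT X, (forall w, 0 <= X w) &
      integrableT (fun w => X w `^ p)].

Lemma Lp_nonneg_norm p X : 0 < p -> measurable_fun setT X -> (forall w, 0 <= X w) ->
  ('N[P]_(p%:E)[EFin \o X] < +oo)%E -> Lp_nonneg p X.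
Proof.
move=> p0 mX X0 XN; split=> //; apply/integrableP; split.
  exact/measurable_EFinP/measurable_fun_powR.
have := poweR_lty p XN.
rewrite poweR_Lnorm ?gt_eqF//; apply: le_lt_trans.
rewrite le_eqVlt; apply/orP; left; apply/eqP; apply: eq_integral => w _ /=.
by rewrite !ger0_norm ?powR_ge0.
Qed.

(** Domination: X <= X^p + 1. *)
Lemma Lp_nonneg_integrable p X : 1 < p -> Lp_nonneg p X -> integrableT X.
Proof.
move=> p1 [mX X0 Xp].
have := integrable_lin3 1 1 0 _ _ _ Xp integrable_cst1 integrable_cst1.
apply: le_integrable => //; first exact/measurable_EFinP.
move=> w _ /=; rewrite lee_fin !ger0_norm ?X0 ?addr_ge0 ?mulr_ge0 ?powR_ge0//.
rewrite !mul1r mul0r addr0.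
have := powR_ge0 (X w) p.
have [X1|X1] := leP (X w) 1; first lra.
by have := le1r_powR (ltW X1) (ltW p1); lra.
Qed.

(** Domination: X^(p-1) Y <= max(X, Y)^p <= X^p + Y^p. *)
Lemma Lp_nonneg_mixed p X Y : 1 < p -> Lp_nonneg p X -> Lp_nonneg p Y ->
  integrableT (fun w => X w `^ (p - 1) * Y w).
Proof.
move=> p1 [mX X0 Xp] [mY Y0 Yp].
have p0 : 0 < p by lra.
have m0 : 0 <= p - 1 by lra.
have := integrable_lin3 1 1 0 _ _ _ Xp Yp integrable_cst1.
apply: le_integrable => //.
  by apply/measurable_EFinP/measurable_funM => //; exact/measurable_fun_powR.
move=> w _ /=; rewrite lee_fin !ger0_norm ?X0 ?addr_ge0 ?mulr_ge0 ?powR_ge0//.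
rewrite !mul1r mul0r addr0.
have [XY|YX] := leP (X w) (Y w).
  apply: le_trans (_ : Y w `^ p <= _); last by rewrite lerDr powR_ge0.
  rewrite -(mulr_powRB1 (Y0 w) p0) mulrC ler_wpM2l//.
  by apply: ge0_ler_powR; rewrite ?nnegrE.
apply: le_trans (_ : X w `^ p <= _); last by rewrite lerDl powR_ge0.
by rewrite -(mulr_powRB1 (X0 w) p0) [leRHS]mulrC ler_wpM2l ?powR_ge0// ltW.
Qed.

(** Jensen's inequality, by integrating the tangent line X^p >= p a^(p-1) X - (p-1) a^p at a = E
    X. *)
Lemma Rintegral_powR_ge p X : 1 < p -> Lp_nonneg p X ->
  (\int[P]_w X w) `^ p <= \int[P]_w (X w `^ p).
Proof.
move=> p1 Xp; have Xi := Lp_nonneg_integrable _ _ p1 Xp.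
case: Xp => mX X0 Xp.
set a := \int[P]_w X w.
have a0 : 0 <= a by exact: Rintegral_ge0.
have p0 : 0 < p by lra.
have m0 : 0 < p - 1 by lra.
have -> : a `^ p = p * a `^ (p - 1) * \int[P]_w X w + - (p - 1) * a `^ p * \int[P]_w (1 : R)
    + 0 * \int[P]_w (1 : R).
  by rewrite Rintegral_cst1 -/a -(mulr_powRB1 a0 p0); ring.
have i1 := integrable_cst1.
rewrite -Rintegral_lin3//; apply: le_Rintegral => //; first exact: integrable_lin3.
by move=> w _; have := young_powR p (X w) a p1 (X0 w) a0; lra.
Qed.

Lemma Ecal_arg_ge0 p theta X : 1 < p -> 0 <= theta <= 1 -> Lp_nonneg p X ->
  0 <= \int[P]_w (X w `^ p) - theta `^ p * (\int[P]_w X w) `^ p.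
Proof.
move=> p1 /andP[t0 t1] Xp; rewrite subr_ge0.
apply: le_trans (Rintegral_powR_ge _ _ p1 Xp).
rewrite ler_piMl ?powR_ge0//.
have := @ge0_ler_powR R p _ theta 1; rewrite powR1; apply; rewrite ?nnegrE//; lra.
Qed.

(** The tangent plane of G at (E X, E Y) is affine, so its integral is its value there, G(E X, E Y).
    The slope in x contains (E X)^(p-2), hence the condition E X > 0. *)
Lemma bregman_jensen p X Y : 1 < p <= 2 -> Lp_nonneg p X -> Lp_nonneg p Y ->
  0 < \int[P]_w X w ->
  (\int[P]_w Y w) `^ p - p * (\int[P]_w X w) `^ (p - 1) * \int[P]_w Y w
    + (p - 1) * (\int[P]_w X w) `^ p <=
  \int[P]_w (Y w `^ p) - p * \int[P]_w (X w `^ (p - 1) * Y w)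
    + (p - 1) * \int[P]_w (X w `^ p).
Proof.
move=> p12 LX LY; have p1 : 1 < p by lra.
have p0 : 0 < p by lra.
have Xi := Lp_nonneg_integrable _ _ p1 LX.
have Yi := Lp_nonneg_integrable _ _ p1 LY.
have XYi := Lp_nonneg_mixed _ _ _ p1 LX LY.
case: LX LY => mX X0 Xp [mY Y0 Yp].
set a := \int[P]_w X w => a0; set b := \int[P]_w Y w.
have b0 : 0 <= b by exact: Rintegral_ge0.
have i1 := integrable_cst1.
have := @le_Rintegral _ _ _ P setT _ _ measurableT
  (integrable_lin3 _ _ _ _ _ _ Xi Yi i1) (integrable_lin3 _ _ _ _ _ _ Yp XYi Xp)
  (fun w _ => bregman_tangent_at p a b (X w) (Y w) p12 a0 b0 (X0 w) (Y0 w)).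
rewrite !Rintegral_lin3// Rintegral_cst1 -/a -/b mul1r mulr1 !mulNr; apply: le_trans.
clearbody a b.
rewrite -(mulr_powRB1 b0 p0) -(mulr_powRB1 (ltW a0) p0).
rewrite le_eqVlt; apply/orP; left; apply/eqP; field.
by rewrite gt_eqF.
Qed.

Lemma Lp_nonnegZ p t X : 0 <= t -> Lp_nonneg p X -> Lp_nonneg p (fun w => t * X w).
Proof.
move=> t0 [mX X0 Xp]; split; [exact: measurable_funM|by move=> w; rewrite mulr_ge0|].
rewrite (_ : _ \o _ = (fun w : T => (t `^ p)%:E * (EFin \o (fun w => (X w `^ p)%R)) w)%E).
  exact: integrableZl.
by apply/funext => w /=; rewrite powRM.
Qed.

(** Domination: (X + Y)^p <= (2 max(X, Y))^p <= 2^p X^p + 2^p Y^p. *)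
Lemma Lp_nonnegD p X Y : 1 < p -> Lp_nonneg p X -> Lp_nonneg p Y ->
  Lp_nonneg p (fun w => X w + Y w).
Proof.
move=> p1 [mX X0 Xp] [mY Y0 Yp]; have p0 : 0 <= p by lra.
split; [exact: measurable_funD|by move=> w; rewrite addr_ge0|].
have := integrable_lin3 (2 `^ p) (2 `^ p) 0 _ _ _ Xp Yp integrable_cst1.
apply: le_integrable => //.
  exact/measurable_EFinP/measurable_fun_powR/measurable_funD.
move=> w _ /=; rewrite lee_fin !ger0_norm ?addr_ge0 ?mulr_ge0 ?powR_ge0//.
rewrite mul0r addr0 -!powRM//.
have [XY|YX] := leP (X w) (Y w).
  apply: le_trans (_ : (2 * Y w) `^ p <= _); last by rewrite lerDr powR_ge0.
  by apply: ge0_ler_powR; rewrite ?nnegrE ?addr_ge0 ?mulr_ge0//; lra.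
apply: le_trans (_ : (2 * X w) `^ p <= _); last by rewrite lerDl powR_ge0.
by apply: ge0_ler_powR; rewrite ?nnegrE ?addr_ge0 ?mulr_ge0//; lra.
Qed.

(** E X = 0 forces X = 0 almost everywhere, and 0^(p-1) = 0 because p > 1. *)
Lemma Rintegral_mixed_eq0 p X Y : 1 < p -> Lp_nonneg p X -> measurable_fun setT Y ->
  \int[P]_w X w = 0 -> \int[P]_w (X w `^ (p - 1) * Y w) = 0.
Proof.
move=> p1 LX mY; have Xi := Lp_nonneg_integrable _ _ p1 LX.
case: LX => mX X0 _ X00.
have X00' : (\int[P]_w (X w)%:E = 0)%E.
  move/eqP: X00; rewrite /Rintegral fine_eq0; first by move/eqP.
  exact: (integrable_fin_num measurableT Xi).
have mEX : measurable_fun setT (EFin \o X) by exact/measurable_EFinP.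
have /(ae_eq_integral_abs _ measurableT mEX) aeX : (\int[P]_w `|(EFin \o X) w| = 0)%E.
  by rewrite -[RHS]X00'; apply: eq_integral => w _ /=; rewrite ger0_norm.
rewrite /Rintegral (@ae_eq_integral _ _ _ P setT (cst 0%E)) ?integral0//.
  by apply/measurable_EFinP/measurable_funM => //; exact: measurable_fun_powR.
apply: filterS aeX => w /= /(_ I) [Xw] _; rewrite Xw powR0 ?mul0r//.
by rewrite gt_eqF//; lra.
Qed.

Lemma excess_hoelder p theta X Y : 1 < p <= 2 -> 0 <= theta <= 1 ->
  Lp_nonneg p X -> Lp_nonneg p Y ->
  Ccal P p theta X Y <= Ecal P p theta X `^ (p - 1) * Ecal P p theta Y.
Proof.
move=> p12 t01 LX LY; have p1 : 1 < p by lra.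
have p0 : 0 < p by lra.
have X0 : forall w, 0 <= X w by case: LX.
have Y0 : forall w, 0 <= Y w by case: LY.
have a0 : 0 <= \int[P]_w X w by exact: Rintegral_ge0.
(* The case E X = 0, outside the reach of [bregman_jensen], makes the left side 0. *)
have [a00|a_neq0] := eqVneq (\int[P]_w X w) 0.
  rewrite CcalE Rintegral_mixed_eq0//; last by case: LY.
  rewrite a00 powR0 ?mulr0 ?mul0r ?subr0 ?mulr_ge0 ?powR_ge0//.
  by rewrite gt_eqF//; lra.
have {a_neq0}a0' : 0 < \int[P]_w X w by rewrite lt_neqAle eq_sym a_neq0.
rewrite CcalE !EcalE//; apply: young_optimize; rewrite ?Ecal_arg_ge0// => t t0.
have := bregman_jensen _ _ _ p12 LX (Lp_nonnegZ _ _ _ (ltW t0) LY) a0'.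
have Yi := Lp_nonneg_integrable _ _ p1 LY.
have XYi := Lp_nonneg_mixed _ _ _ p1 LX LY.
rewrite RintegralZl//.
have -> : \int[P]_w ((t * Y w) `^ p) = t `^ p * \int[P]_w (Y w `^ p).
  rewrite -RintegralZl//; last by case: LY.
  by apply: eq_Rintegral => w _; rewrite powRM// ltW.
have -> : \int[P]_w (X w `^ (p - 1) * (t * Y w)) = t * \int[P]_w (X w `^ (p - 1) * Y w).
  rewrite -RintegralZl//.
  by apply: eq_Rintegral => w _; rewrite mulrCA.
have b0 : 0 <= \int[P]_w Y w by exact: Rintegral_ge0.
clear -p1 p0 t01 a0 b0 t0.
move: (\int[P]_w X w) (\int[P]_w Y w) (\int[P]_w (X w `^ p)) (\int[P]_w (Y w `^ p))
  (\int[P]_w (X w `^ (p - 1) * Y w)) a0 b0 => a b cX cY m a0 b0.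
have := young_powR p (t * b) a p1 (mulr_ge0 (ltW t0) b0) a0.
rewrite powRM ?(ltW t0)//.
(* Since G(E X, t E Y) >= 0 and theta^p <= 1, the lower bound G may be weakened to theta^p G; this
   produces the theta terms of all three quantities at once. *)
have tau1 : theta `^ p <= 1.
  have := @ge0_ler_powR R p (ltW p0) theta 1; rewrite powR1; apply; rewrite ?nnegrE//; lra.
set G := t `^ p * b `^ p - p * a `^ (p - 1) * (t * b) + (p - 1) * a `^ p => hG hJ.
have G0 : 0 <= G by rewrite /G; lra.
have := le_trans (ler_piMl G0 tau1) hJ.
rewrite /G; lra.
Qed.

(** Splitting one factor Z off Z^p and off (E Z)^p gives Ecal(Z)^p = Ccal(Z, X) + Ccal(Z, Y); then
    divide by Ecal(Z)^(p-1). The two Hoelder instances are hypotheses so that the contrapositive can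
    serve for p > 2. *)
Lemma excess_minkowski_of_hoelder p theta X Y : 1 < p -> 0 <= theta <= 1 ->
  Lp_nonneg p X -> Lp_nonneg p Y ->
  let Z := fun w => X w + Y w in
  Ccal P p theta Z X <= Ecal P p theta Z `^ (p - 1) * Ecal P p theta X ->
  Ccal P p theta Z Y <= Ecal P p theta Z `^ (p - 1) * Ecal P p theta Y ->
  Ecal P p theta Z <= Ecal P p theta X + Ecal P p theta Y.
Proof.
move=> p1 t01 LX LY Z; have p0 : 0 < p by lra.
move=> hX hY.
have LZ : Lp_nonneg p Z by exact: Lp_nonnegD.
have Z0 : forall w, 0 <= Z w by case: LZ.
have [E0|E0] := eqVneq (Ecal P p theta Z) 0.
  by rewrite E0 addr_ge0// powR_ge0.
have {}E0 : 0 < Ecal P p theta Z by rewrite lt_neqAle eq_sym E0 powR_ge0.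
rewrite -(ler_pM2l (powR_gt0 (p - 1) E0)) mulrDr.
apply: le_trans (lerD hX hY).
rewrite mulrC mulr_powRB1 ?(ltW E0)// !CcalE EcalE// -powRrM mulVf ?gt_eqF//.
rewrite powRr1 ?Ecal_arg_ge0//.
have -> : \int[P]_w (Z w `^ p) =
    \int[P]_w (Z w `^ (p - 1) * X w) + \int[P]_w (Z w `^ (p - 1) * Y w).
  rewrite -RintegralD//; [|exact: Lp_nonneg_mixed..].
  by apply: eq_Rintegral => w _; rewrite -mulr_powRB1// mulrC mulrDr.
have ZE : \int[P]_w Z w = \int[P]_w X w + \int[P]_w Y w.
  by rewrite RintegralD//; exact: (Lp_nonneg_integrable p).
have z0 : 0 <= \int[P]_w Z w by exact: Rintegral_ge0.
rewrite -(mulr_powRB1 z0 p0) [X in theta `^ p * (X * _)]ZE.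
by rewrite le_eqVlt; apply/orP; left; apply/eqP; ring.
Qed.

End moments.

(** * Second differences for p > 2 *)

(* Power mean: (1 + (1+2t)^p) / 2 >= ((1 + (1+2t)^2) / 2)^(p/2) = ((1+t)^2 + t^2)^(p/2). *)
Lemma powR_second_difference {R : realType} (p t : R) : 2 <= p -> 0 <= t ->
  2 * t ^+ 2 <= 1 + (1 + 2 * t) `^ p - 2 * (1 + t) `^ p.
Proof.
move=> p2 t0; pose r := p / 2.
have r1 : 1 <= r by rewrite /r ler_pdivlMr//; lra.
have r0 : 0 < r by lra.
have sq (z : R) : 0 <= z -> (z ^+ 2) `^ r = z `^ p.
  move=> z0; rewrite -powR_mulrn// -powRrM; congr (_ `^ _); rewrite /r; lra.
have t1 : 0 <= 1 + t by lra.
have half : 0 <= (2^-1 : R) <= 1 by lra.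
have t2 : 0 <= 1 + 2 * t by lra.
pose M := (1 + t) ^+ 2.
have M1 : 1 <= M by rewrite /M; nra.
have ME : 2^-1 * 1 + (1 - 2^-1) * (1 + 2 * t) ^+ 2 = M + t ^+ 2 by rewrite /M; field.
have := powR_conv r 2^-1 1 ((1 + 2 * t) ^+ 2) r1 half ler01 (sqr_ge0 _).
rewrite ME powR1 sq// => h.
(* As M >= 1 and r >= 1, with h = t^2: (M + h)^r >= (M + h) M^(r-1) >= M^r + h. *)
have : M `^ r + t ^+ 2 <= (M + t ^+ 2) `^ r.
  have Mt0 : 0 <= M + t ^+ 2 by rewrite addr_ge0 ?sqr_ge0//; lra.
  have M0 : 0 <= M by lra.
  rewrite -(mulr_powRB1 Mt0 r0).
  apply: le_trans (_ : (M + t ^+ 2) * M `^ (r - 1) <= _).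
    rewrite mulrDl mulr_powRB1// lerD2l ler_peMr ?sqr_ge0//.
    by have := @ler_powR R M M1 0 (r - 1); rewrite powRr0; apply; lra.
  rewrite ler_wpM2l//; apply: ge0_ler_powR; rewrite ?nnegrE//; first lra.
  by rewrite lerDl sqr_ge0.
rewrite /M sq//; lra.
Qed.

(** This is F(X_s), where X_s is s or 1 with probability 1/2 each. *)
Definition coin_excess {R : realType} (p theta s : R) :=
  2^-1 * s `^ p + 2^-1 - theta `^ p * (2^-1 * s + 2^-1) `^ p.

Lemma coin_excess_midpoint_gt {R : realType} (p theta : R) : 2 < p -> 0 < theta ->
  let f := coin_excess p theta in
  exists2 t, 0 < t & f 0 + f (2 * t) < 2 * f t.
Proof.
move=> p2 th0 f.
have D0 : 0 < (2 : R) `^ p by rewrite powR_gt0.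
set D := (2 : R) `^ p in D0.
have tau0 : 0 < theta `^ p by rewrite powR_gt0.
have fE s : 0 <= s -> f s = 2^-1 * s `^ p + 2^-1 - theta `^ p * ((1 + s) `^ p / D).
  move=> s0; rewrite /f /coin_excess; congr (_ - _ * _).
  apply: (canRL (mulfK _)); first by rewrite gt_eqF.
  rewrite /D -powRM//; last by rewrite addr_ge0// mulr_ge0.
  by congr (_ `^ _); field.
(* Chosen so that t^p = theta^p t^2 / D^2: the loss D t^p / 2 from the term s^p is then theta^p t^2
   / (2 D), below the gain 2 theta^p t^2 / D from the second difference. *)
pose t := (theta `^ p / (D * D)) `^ (p - 2)^-1.
have c0 : 0 < theta `^ p / (D * D) by rewrite divr_gt0// mulr_gt0.
have t0 : 0 < t by rewrite powR_gt0.
have tp : t `^ p = theta `^ p / (D * D) * t ^+ 2.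
  rewrite -[in LHS](subrK 2 p) powRD; last by rewrite (gt_eqF t0) implybT.
  rewrite powR_mulrn ?(ltW t0)//; congr (_ * _).
  rewrite /t -powRrM mulVf ?powRr1 ?(ltW c0)//.
  by rewrite gt_eqF// subr_gt0.
exists t => //; rewrite !fE ?mulr_ge0 ?(ltW t0)// powR0 ?powRM ?(ltW t0)//;
  last by rewrite gt_eqF//; lra.
rewrite addr0 powR1 -/D tp.
have := powR_second_difference p t (ltW p2) (ltW t0).
have k0 : 0 < theta `^ p / D by rewrite divr_gt0.
move=> /(ler_wpM2l (ltW k0)).
have tt0 : 0 < t ^+ 2 by rewrite exprn_gt0.
have := mulr_gt0 c0 tt0; have := mulr_gt0 k0 tt0.
have -> : D * (theta `^ p / (D * D) * t ^+ 2) = theta `^ p / D * t ^+ 2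
  by field; rewrite gt_eqF.
have invDE u : theta `^ p * (u / D) = theta `^ p / D * u by field; rewrite gt_eqF.
rewrite !invDE; lra.
Qed.

(** * The fair coin and the counterexamples for p > 2 *)

Section fair_coin.
Context {R : realType}.

Definition fair_coin : probability bool R := bernoulli_prob (2^-1).

Lemma measurable_fun_bool (f : bool -> R) : measurable_fun setT f.
Proof. by []. Qed.

Definition bool_rv (f : bool -> R) : {RV fair_coin >-> R} :=
  mfun_Sub (mem_set (measurable_fun_bool f)).

Lemma integral_fair_coin (f : bool -> R) : (forall b, 0 <= f b) ->
  (\int[fair_coin]_b (f b)%:E = (2^-1 * f true + 2^-1 * f false)%:E)%E.
Proof.
move=> f0; rewrite integral_bernoulli_prob//; last by lra.
rewrite -!EFinM -EFinD; congr (_ + _ * _)%:E.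
by rewrite -[LHS]/(1 - 2^-1); lra.
Qed.

Lemma Rintegral_fair_coin (f : bool -> R) : (forall b, 0 <= f b) ->
  \int[fair_coin]_b f b = 2^-1 * f true + 2^-1 * f false.
Proof. by move=> f0; rewrite /Rintegral (integral_fair_coin _ f0). Qed.

Lemma fair_coin_norm_lty (r : R) (f : bool -> R) :
  ('N[fair_coin]_(r%:E)[EFin \o f] < +oo)%E.
Proof.
rewrite unlock; apply: poweR_lty => /=.
by rewrite integral_fair_coin ?ltry// => b; exact: powR_ge0.
Qed.

Lemma admissible_fair_coin (p q : R) (f g : bool -> R) :
  (forall b, 0 <= f b) -> (forall b, 0 <= g b) ->
  admissible fair_coin p q (bool_rv f) (bool_rv g).
Proof. by move=> f0 g0; split=> //; exact: fair_coin_norm_lty. Qed.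

Lemma Ecal_fair_coin (p theta : R) (f : bool -> R) : 0 < p -> (forall b, 0 <= f b) ->
  Ecal fair_coin p theta f =
  (2^-1 * f true `^ p + 2^-1 * f false `^ p
    - theta `^ p * (2^-1 * f true + 2^-1 * f false) `^ p) `^ p^-1.
Proof.
move=> p0 f0; rewrite (EcalE _ _ _ _ p0 f0) (Rintegral_fair_coin _ f0).
by rewrite (Rintegral_fair_coin _ (fun b => powR_ge0 (f b) p)).
Qed.

Lemma Lp_nonneg_fair_coin (p : R) (f : bool -> R) : 0 < p -> (forall b, 0 <= f b) ->
  Lp_nonneg fair_coin p f.
Proof. by move=> p0 f0; apply: Lp_nonneg_norm => //; exact: fair_coin_norm_lty. Qed.

Lemma excess_minkowski_fails (p theta : R) : 2 < p -> 0 < theta <= 1 ->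
  exists f g : bool -> R, [/\ forall b, 0 <= f b, forall b, 0 <= g b &
    ~ (Ecal fair_coin p theta (fun b => f b + g b)
       <= Ecal fair_coin p theta f + Ecal fair_coin p theta g)].
Proof.
move=> p2 /andP[th0 th1].
have p0 : 0 < p by lra.
have p1 : 1 < p by lra.
have [t t0 hF] := coin_excess_midpoint_gt p theta p2 th0.
pose F := coin_excess p theta; rewrite -/F in hF.
pose X (s : R) (b : bool) := if b then s else 1.
have X0 s : 0 <= s -> forall b, 0 <= X s b by move=> s0 [].
have t20 : 0 <= 2 * t by lra.
exists (X 0), (X (2 * t)); split; [exact: X0|exact: X0|].
have EX s : 0 <= s -> Ecal fair_coin p theta (X s) = F s `^ p^-1.
  by move=> s0; rewrite (Ecal_fair_coin _ _ _ p0 (X0 s s0))/= powR1 !mulr1.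
have F0 s : 0 <= s -> 0 <= F s.
  move=> s0.
  have t01 : 0 <= theta <= 1 by lra.
  have := Ecal_arg_ge0 _ _ _ _ p1 t01 (Lp_nonneg_fair_coin p _ p0 (X0 s s0)).
  rewrite (Rintegral_fair_coin _ (X0 s s0)).
  by rewrite (Rintegral_fair_coin _ (fun b => powR_ge0 (X s b) p))/= powR1 !mulr1.
have Z0 b : 0 <= X 0 b + X (2 * t) b by rewrite addr_ge0// X0.
rewrite (EX 0 (lexx 0)) (EX _ t20) (Ecal_fair_coin _ _ _ p0 Z0)/=.
(* X_0 + X_2t takes the values 2t and 2, so it is 2 X_t, and F is homogeneous of degree p. *)
have -> : 2^-1 * (0 + 2 * t) `^ p + 2^-1 * (1 + 1) `^ p -
   theta `^ p * (2^-1 * (0 + 2 * t) + 2^-1 * (1 + 1)) `^ p = 2 `^ p * F t.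
  have -> : 2^-1 * (0 + 2 * t) + 2^-1 * (1 + 1) = 2 * (2^-1 * t + 2^-1) by field.
  have -> : 0 + 2 * t = 2 * t by ring.
  have -> : 1 + 1 = 2 :> R by ring.
  have s0 : 0 <= 2^-1 * t + 2^-1 by lra.
  rewrite (@powRM _ 2 t)//; last exact: ltW.
  rewrite (@powRM _ 2 (_ + _))//.
  by rewrite /F /coin_excess; ring.
have Ft0 := F0 t (ltW t0).
rewrite powRM ?powR_ge0// -powRrM mulfV ?gt_eqF// powRr1//.
have A0 := F0 0 (lexx 0); have B0 := F0 _ t20.
move: (F 0) (F (2 * t)) (F t) hF A0 B0 Ft0 => A B C ABC A0 B0 C0.
clear -p0 p1 ABC A0 B0 C0.
have half : 0 <= (2^-1 : R) <= 1 by lra.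
(* Concavity of the p-th root, in the form ((A^(1/p) + B^(1/p)) / 2)^p <= (A + B) / 2 < C; the
   Minkowski-type inequality would bound C by the left side. *)
have := powR_conv p 2^-1 _ _ (ltW p1) half (powR_ge0 A p^-1) (powR_ge0 B p^-1).
have rK (x : R) : 0 <= x -> (x `^ p^-1) `^ p = x.
  by move=> x0; rewrite -powRrM mulVf ?gt_eqF// powRr1.
rewrite !rK// => h1 h2.
have : (C `^ p^-1) `^ p <= (2^-1 * A `^ p^-1 + (1 - 2^-1) * B `^ p^-1) `^ p.
  have := powR_ge0 C p^-1; have := powR_ge0 A p^-1; have := powR_ge0 B p^-1 => ? ? ?.
  by apply: ge0_ler_powR; rewrite ?nnegrE; lra.
rewrite rK//; lra.
Qed.

End fair_coin.

(** For f, g violating the Minkowski-type inequality, the Hoelder-type one fails for (f + g, f) or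
    for (f + g, g), since both together would imply the former. *)
Lemma excess_hoelder_fails {R : realType} (p theta : R) : 2 < p -> 0 < theta <= 1 ->
  exists f g : bool -> R, [/\ forall b, 0 <= f b, forall b, 0 <= g b &
    ~ (Ccal fair_coin p theta f g
       <= Ecal fair_coin p theta f `^ (p - 1) * Ecal fair_coin p theta g)].
Proof.
move=> p2 th.
have p0 : 0 < p by lra.
have p1 : 1 < p by lra.
have th' : 0 <= theta <= 1 by lra.
have [f [g [f0 g0 fg]]] := excess_minkowski_fails p theta p2 th.
have Z0 b : 0 <= f b + g b by rewrite addr_ge0.
have [hf|/negP hf] := boolP (Ccal fair_coin p theta (fun b => f b + g b) f
    <= Ecal fair_coin p theta (fun b => f b + g b) `^ (p - 1) * Ecal fair_coin p theta f);
  last by exists (fun b => f b + g b), f; split; [exact: Z0|exact: f0|exact: hf].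
exists (fun b => f b + g b), g; split; [exact: Z0|exact: g0|move=> hg; apply: fg].
exact: (excess_minkowski_of_hoelder _ _ _ _ _ p1 th'
  (Lp_nonneg_fair_coin _ _ p0 f0) (Lp_nonneg_fair_coin _ _ p0 g0) hf hg).
Qed.

Theorem theorem1 (R : realType) (p q : R) (hp : 1 < p) (hq : 1 < q)
    (hpq : p^-1 + q^-1 = 1) :
  (p <= 2 ->
    forall theta : R, 0 <= theta <= 1 ->
    forall (d : measure_display) (T : measurableType d) (P : probability T R)
           (X Y : {RV P >-> R}),
      admissible P p q X Y ->
      Ecal P p theta (fun w => X w + Y w) <= Ecal P p theta X + Ecal P p theta Y
      /\ Ccal P p theta X Y <= Ecal P p theta X `^ (p - 1) * Ecal P p theta Y)
  /\
  (2 < p ->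
    forall theta : R, 0 < theta <= 1 ->
      (exists (d : measure_display) (T : measurableType d) (P : probability T R)
              (X Y : {RV P >-> R}),
         admissible P p q X Y /\
         ~ (Ecal P p theta (fun w => X w + Y w)
              <= Ecal P p theta X + Ecal P p theta Y))
      /\
      (exists (d : measure_display) (T : measurableType d) (P : probability T R)
              (X Y : {RV P >-> R}),
         admissible P p q X Y /\
         ~ (Ccal P p theta X Y <= Ecal P p theta X `^ (p - 1) * Ecal P p theta Y))).
Proof.
have p0 : 0 < p by exact: lt_trans hp.
split.
  move=> p2 theta th d T P X Y [X0 Y0 NX NY _].
  have p12 : 1 < p <= 2 by rewrite hp.
  have LX : Lp_nonneg P p X by exact: Lp_nonneg_norm.
  have LY : Lp_nonneg P p Y by exact: Lp_nonneg_norm.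
  have LZ := Lp_nonnegD _ _ _ _ hp LX LY.
  split; last exact: excess_hoelder.
  by apply: excess_minkowski_of_hoelder => //; exact: excess_hoelder.
move=> p2 theta th; split.
  have [f [g [f0 g0 fg]]] := excess_minkowski_fails p theta p2 th.
  exists _, _, fair_coin, (bool_rv f), (bool_rv g).
  by split; [exact: admissible_fair_coin|exact: fg].
have [f [g [f0 g0 fg]]] := excess_hoelder_fails p theta p2 th.
exists _, _, fair_coin, (bool_rv f), (bool_rv g).
by split; [exact: admissible_fair_coin|exact: fg].
Qed.
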